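(* For every positive integer $n$, $$\operatorname{st}_{+}\big(A(1,1/2,\ldots,1/n)\big)\le 2\lceil\log_2 n\rceil .$$
   Context: For real numbers $x_1,\ldots,x_n$, the associated Euclidean distance matrix is the $n\times n$ symmetric nonnegative matrix $A(x_1,\ldots,x_n):=\big(|x_i-x_j|^2\big)_{i,j=1}^n$; here $x_i=1/i$ for $i=1,\ldots,n$. $\mathbb{R}_{+}^{m\times n}$ is the set of $m\times n$ real matrices with nonnegative entries and $\mathcal{S}_n^{+}$ is the set of symmetric $n\times n$ matrices with nonnegative entries. For $A\in\mathcal{S}_n^{+}$, an SN-Trifactorization of $A$ is a factorization $A=BCB^{T}$ with $B\in\mathbb{R}_{+}^{n\times k}$ and $C\in\mathcal{S}_k^{+}$; the SNT-rank $\operatorname{st}_{+}(A)$ is the smallest integer $k$ for which such a factorization exists, with the convention $\operatorname{st}_{+}(0)=0$. *)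

(* Defs.v *)
From mathcomp Require Import all_boot all_order all_algebra.
From mathcomp Require Import boolp reals exp.

Set Implicit Arguments.
Unset Strict Implicit.
Unset Printing Implicit Defensive.

Import Order.TTheory GRing.Theory Num.Theory.

Local Open Scope ring_scope.

Definition sym_nonneg (R : realType) n (A : 'M[R]_n) : bool :=
  (A^T == A) && (A \is a mxOver Num.nneg).

Definition is_sn_trifact (R : realType) n k (A : 'M[R]_n)
    (B : 'M[R]_(n, k)) (C : 'M[R]_k) : Prop :=
  [/\ B \is a mxOver Num.nneg, sym_nonneg C & A = B *m C *m B^T].

Definition has_sn_trifact (R : realType) n (A : 'M[R]_n) (k : nat) : Prop :=
  exists (B : 'M[R]_(n, k)) (C : 'M[R]_k), is_sn_trifact A B C.

Lemma ex_sn_trifact (R : realType) n (A : 'M[R]_n) :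
  sym_nonneg A -> exists k, `[< has_sn_trifact A k >].
Proof.
move=> SA; exists n; apply/asboolP; exists 1%:M, A; split=> //.
  by rewrite mxOver_scalar // nnegrE.
by rewrite mul1mx trmx1 mulmx1.
Qed.

Definition snt_rank (R : realType) n (A : 'M[R]_n) (SA : sym_nonneg A) : nat :=
  ex_minn (ex_sn_trifact SA).
Arguments snt_rank {R n} A SA.

(* The inner dimension k = 0 is allowed, so the convention st_+(0) = 0 is
   a consequence of the definition. *)
Lemma snt_rank0 (R : realType) n (S0 : sym_nonneg (0 : 'M[R]_n)) :
  snt_rank 0 S0 = 0%N.
Proof.
rewrite /snt_rank; case: ex_minnP => k _ kmin.
apply/eqP; rewrite -leqn0; apply: kmin; apply/asboolP.
exists 0, 0; split; last by rewrite mulmx0 mul0mx.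
  by rewrite thinmxOver.
by rewrite /sym_nonneg trmx0 eqxx thinmxOver.
Qed.

Definition edm (R : realType) n (x : 'I_n -> R) : 'M[R]_n :=
  \matrix_(i, j) `|x i - x j| ^+ 2.

Lemma edm_sym_nonneg (R : realType) n (x : 'I_n -> R) : sym_nonneg (edm x).
Proof.
apply/andP; split; first by apply/eqP/matrixP => i j; rewrite !mxE distrC.
by apply/mxOverP => i j; rewrite mxE nnegrE exprn_ge0.
Qed.

(* 'I_n is 0-based, hence the shift. *)
Definition inv_points (R : realType) n : 'I_n -> R := fun i => i.+1%:R^-1.
Arguments inv_points R n : clear implicits.

Definition log2 (R : realType) (x : R) : R := ln x / ln 2.

(* Main.v *)
(* Since (1/i - 1/j)^2 = (i - j)^2 / (i j)^2, a positive diagonal scaling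
   reduces to the points 0, ..., n - 1, and taking a principal submatrix to
   n = 2^k.  Folding the real line at the midpoint c of these points identifies
   them in pairs: with u = x - c, p = |u| + u and q = |u| - u,
   (x - x')^2 = (|u| - |u'|)^2 + p q' + q p',
   so each halving of the number of points costs an inner dimension of 2. *)
Require Import Defs.
From mathcomp Require Import all_boot all_order all_algebra.
From mathcomp Require Import boolp reals exp.
From mathcomp Require Import zify ring lra.

Import Order.TTheory GRing.Theory Num.Theory.

Local Open Scope ring_scope.

Lemma mxsub_trifact (R : pzSemiRingType) m n k (f : 'I_n -> 'I_m)
    (B : 'M[R]_(m, k)) (C : 'M[R]_k) :
  mxsub f f (B *m C *m B^T) = rowsub f B *m C *m (rowsub f B)^T.
Proof.
rewrite mul_rowsub_mx; apply/matrixP => i j; rewrite !mxE.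
by apply: eq_bigr => l _; rewrite !mxE.
Qed.

Lemma snt_rank_le (R : realType) n k (A : 'M[R]_n) (SA : sym_nonneg A) :
  has_sn_trifact A k -> (snt_rank A SA <= k)%N.
Proof.
by move=> Ak; rewrite /snt_rank; case: ex_minnP => r _; apply; apply/asboolP.
Qed.

(** Row selection and nonnegative row scaling are absorbed into [B], so [C] and the inner dimension
    stay the same. *)
Lemma has_sn_trifact_scale (R : realType) m n k (f : 'I_n -> 'I_m)
    (d : 'rV[R]_n) (A : 'M[R]_m) :
  d \is a mxOver Num.nneg -> has_sn_trifact A k ->
  has_sn_trifact (diag_mx d *m mxsub f f A *m diag_mx d) k.
Proof.
move=> d_ge0 [B [C [/mxOverP B_ge0 SC ->]]].
exists (diag_mx d *m rowsub f B), C; split=> //.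
  apply/mxOverP => i j; rewrite mul_diag_mx !mxE.
  by rewrite rpredM ?(mxOverP d_ge0).
by rewrite mxsub_trifact trmx_mul tr_diag_mx !mulmxA.
Qed.

(** Distances ignore translations, so the offset [d] leaves [edm z] unchanged and lets the folded
    points be renumbered from 0. *)
Lemma has_sn_trifact_fold (R : realType) m n k (f : 'I_n -> 'I_m)
    (x : 'I_n -> R) (z : 'I_m -> R) (c d : R) :
  (forall i, `|x i - c| = z (f i) + d) ->
  has_sn_trifact (edm z) k -> has_sn_trifact (edm x) (k + 2).
Proof.
move=> xz [B [C [/mxOverP B_ge0 /andP[/eqP CT /mxOverP C_ge0] zE]]].
pose u i := x i - c.
(* The columns of [P] are p and q; [S] swaps them, so [P *m S *m P^T] has entries p q' + q p'. *)
pose P : 'M[R]_(n, 2) := \matrix_(i, j) (`|u i| + (-1) ^+ j * u i).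
pose S : 'M[R]_2 := \matrix_(i, j) (i != j)%:R.
exists (row_mx (rowsub f B) P), (block_mx C 0 0 S); split.
- apply/mxOverP => i j; rewrite mxE; case: splitP => l _; rewrite mxE //.
  by rewrite nnegrE -lerBlDr sub0r -normrN -[in leRHS](normrMsign l) mulrN ler_norm.
- apply/andP; split.
    rewrite tr_block_mx CT !trmx0; apply/eqP; congr block_mx.
    by apply/matrixP => i j; rewrite !mxE eq_sym.
  apply/mxOverP => i j; rewrite mxE; case: splitP => l _; rewrite mxE;
    case: splitP => l' _; rewrite ?mxE ?rpred0 //.
  by rewrite nnegrE ler0n.
rewrite mul_row_block tr_row_mx mul_row_col !mulmx0 addr0 add0r.
rewrite -mxsub_trifact -zE; apply/matrixP => i j.
rewrite !mxE !big_ord_recl big_ord0 !mxE !big_ord_recl !big_ord0 !mxE /=.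
have -> : z (f i) - z (f j) = `|u i| - `|u j| by rewrite /u !xz; ring.
have -> : x i - x j = u i - u j by rewrite /u; ring.
rewrite !real_normK ?num_real // expr0 expr1.
have ui := real_normK (num_real (u i)); have uj := real_normK (num_real (u j)).
(* The cross terms in |u| |u'| cancel; what remains needs only |u|^2 = u^2. *)
ring: ui uj.
Qed.

Lemma has_sn_trifact_nat_edm (R : realType) k :
  has_sn_trifact (edm (fun i : 'I_(2 ^ k) => i%:R : R)) (2 * k).
Proof.
elim: k => [|k IHk].
  (* A single point has the zero distance matrix, so inner dimension 0 suffices. *)
  exists 0, 0; split; rewrite ?thinmxOver //.
    by rewrite /sym_nonneg trmx0 eqxx thinmxOver.
  rewrite mulmx0 mul0mx; apply/matrixP => i j.
  by rewrite !mxE !ord1 subrr normr0 expr0n.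
rewrite mulnS addnC.
have k2 : (0 < 2 ^ k)%N by rewrite expn_gt0.
(* Folding at the midpoint 2^k - 1/2 reverses the lower half and shifts the upper one; distances to
   it are half-integers from 1/2 on, hence the offset 1/2. *)
have fP (i : 'I_(2 ^ k.+1)) :
    ((if (i < 2 ^ k)%N then 2 ^ k - i.+1 else i - 2 ^ k) < 2 ^ k)%N.
  have : (i < 2 * 2 ^ k)%N by rewrite -expnS.
  by case: ifP; lia.
apply: (has_sn_trifact_fold _ _ _ _ (fun i => Ordinal (fP i)) _ _
  ((2 ^ k)%:R - 2^-1) 2^-1) IHk => i /=.
case: ltnP => ik.
  have : i.+1%:R <= (2 ^ k)%:R :> R by rewrite ler_nat.
  rewrite natrB // -(natr1 i) => le_ik.
  by rewrite ler0_norm; lra.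
have : (2 ^ k)%:R <= i%:R :> R by rewrite ler_nat.
by rewrite natrB // => le_ki; rewrite ger0_norm; lra.
Qed.

(** The index shift in [inv_points] cancels in the numerator (j + 1) - (i + 1), so points starting
    at 0 serve. *)
Lemma edm_inv_points (R : realType) m n (le_nm : (n <= m)%N) :
  let f := widen_ord le_nm in let d := \row_i inv_points R n i ^+ 2 in
  edm (inv_points R n) =
  diag_mx d *m mxsub f f (edm (fun i : 'I_m => i%:R)) *m diag_mx d.
Proof.
move=> f d; apply/matrixP => i j.
rewrite mul_mx_diag mul_diag_mx !mxE /= !real_normK ?num_real //.
rewrite /inv_points -!natr1; field.
by rewrite !natr1 !pnatr_eq0.
Qed.

Theorem corollary4p3 (R : realType) (n : nat) (n_gt0 : (0 < n)%N) :
  (snt_rank (edm (inv_points R n)) (edm_sym_nonneg (inv_points R n)))%:Z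
    <= 2 * Num.ceil (log2 (n%:R : R)).
Proof.
have ln2_gt0 : 0 < ln 2 :> R by rewrite ln_gt0 ?ltr1n.
(* Nonnegativity makes the ceiling a natural number [k], usable as the exponent of 2. *)
have : 0 <= Num.ceil (log2 (n%:R : R)).
  by rewrite ceil_ge0 (lt_le_trans (ltrN10 _)) // divr_ge0 ?ln_ge0 ?ler1n // ltW.
case E: Num.ceil => [k|//] _.
have le_n2k : (n <= 2 ^ k)%N.
  rewrite -(ler_nat R) natrX -ler_ln ?posrE ?exprn_gt0 ?ltr0n //.
  rewrite lnXn // -[leRHS]mulr_natl -ler_pdivrMr //.
  by have := ceil_ge (log2 (n%:R : R)); rewrite E.
rewrite -PoszM lez_nat; apply: snt_rank_le.
rewrite (edm_inv_points _ _ _ le_n2k); apply: has_sn_trifact_scale.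
  by apply/mxOverP => i j; rewrite mxE nnegrE exprn_ge0 ?invr_ge0.
exact: has_sn_trifact_nat_edm.
Qed.
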